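(* There exists an infinitely renormalizable $C^{1+Lip}$ unimodal map $f$ with quadratic tip such that $\{c_n\}_{n\ge0}$ is dense in a Cantor set, where $c_n$ is the critical point of $R^nf$. (That is, there is a Cantor set which contains $\{c_n\}_{n\ge 0}$ as a dense subset.)
   Context: A unimodal map $f:[0,1]\to[0,1]$ is a $C^1$ map with $f(1)=0$, with a unique point $c\in(0,1)$ (the critical point) where $Df(c)=0$, and with $f(c)=1$. It is $C^{1+Lip}$ if $Df$ is Lipschitz. The critical point $c$ is a quadratic tip if there exist a sequence $x_n\to c$ (with $x_n\neq c$) and a constant $A>0$ such that $\lim_{n\to\infty}\frac{f(x_n)-f(c)}{(x_n-c)^2}=-A$. A unimodal map $f$ with quadratic tip $c$ is renormalizable if (1) $c\in[f^2(c),f^4(c)]=:I_0^1$, (2) $f(I_0^1)=[f^3(c),f(c)]=:I_1^1$, (3) $I_0^1\cap I_1^1=\emptyset$. The renormalization of $f$ is $Rf=h^{-1}\circ f^2\circ h$, where $h:[0,1]\to I_0^1$ is the orientation reversing affine homeomorphism; $Rf$ is again a unimodal map. The map $f$ is infinitely renormalizable if $R^nf$ is defined and renormalizable for all $n\ge0$. *)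

(* Defs.v *)
From HB Require Import structures.
From mathcomp Require Import all_boot all_order all_algebra.
From mathcomp Require Import all_classical all_reals all_analysis.

Set Implicit Arguments.
Unset Strict Implicit.
Unset Printing Implicit Defensive.

Import Order.TTheory GRing.Theory Num.Theory.
Import numFieldNormedType.Exports.

Local Open Scope classical_set_scope.
Local Open Scope ring_scope.

(* A map of the unit interval is represented by a total function [R -> R] of
   which only the restriction to [0, 1] matters. *)
Definition unit_interval (R : realType) : set R := `[0, 1].

(* The derivative of [f] as a map defined on [0, 1]: the difference quotient is
   taken along points of [0, 1], hence one-sided at 0 and 1. *)
Definition diff_quot (R : realType) (f : R -> R) (x y : R) : R :=
  (f y - f x) / (y - x).

Definition derivable01 (R : realType) (f : R -> R) (x : R) : Prop :=
  cvg (diff_quot f x y @[y --> within (@unit_interval R) x^']).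

Definition deriv01 (R : realType) (f : R -> R) (x : R) : R :=
  lim (diff_quot f x y @[y --> within (@unit_interval R) x^']).

Definition C1_01 (R : realType) (f : R -> R) : Prop :=
  (forall x, unit_interval x -> derivable01 f x) /\
  {within @unit_interval R, continuous (deriv01 f)}.

Definition C1Lip_01 (R : realType) (f : R -> R) : Prop :=
  C1_01 f /\ [lipschitz (deriv01 f x : R^o) | x in @unit_interval R].

Definition critical_point (R : realType) (f : R -> R) (c : R) : Prop :=
  0 < c < 1 /\ deriv01 f c = 0.

Definition unimodal (R : realType) (f : R -> R) : Prop :=
  [/\ f @` @unit_interval R `<=` @unit_interval R,
      C1_01 f,
      f 1 = 0 &
      exists c, unique (critical_point f) c /\ f c = 1].

(* The critical point of [f]; arbitrary if [f] has none or several. *)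
Definition crit (R : realType) (f : R -> R) : R := get (critical_point f).

Definition quadratic_tip (R : realType) (f : R -> R) (c : R) : Prop :=
  exists (x : R ^nat) (A : R),
    [/\ 0 < A,
        forall n, unit_interval (x n) /\ x n != c,
        x @ \oo --> c &
        (fun n => (f (x n) - f c) / (x n - c) ^+ 2) @ \oo --> - A].

Definition I01 (R : realType) (f : R -> R) : set R :=
  `[iter 2 f (crit f), iter 4 f (crit f)].

Definition I11 (R : realType) (f : R -> R) : set R :=
  `[iter 3 f (crit f), f (crit f)].

Definition renormalizable (R : realType) (f : R -> R) : Prop :=
  [/\ unimodal f /\ quadratic_tip f (crit f),
      I01 f (crit f),
      f @` I01 f = I11 f &
      I01 f `&` I11 f = set0].

(* [line_path a b] is the affine map sending 0 to [a] and 1 to [b], with inverse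
   [factor a b].  The right endpoint of [I01 f] comes first, so that the
   rescaling of [0, 1] onto [I01 f] reverses orientation. *)
Definition renormalization (R : realType) (f : R -> R) (x : R) : R :=
  let h := line_path (iter 4 f (crit f)) (iter 2 f (crit f)) in
  let h_inv := factor (iter 4 f (crit f)) (iter 2 f (crit f)) in
  h_inv (iter 2 f (h x)).

Definition infinitely_renormalizable (R : realType) (f : R -> R) : Prop :=
  forall n : nat, renormalizable (iter n (@renormalization R) f).

Definition cantor_set (R : realType) (K : set R) : Prop :=
  [/\ K !=set0, compact K, perfect_set K & totally_disconnected K].

(* Main.v *)
Require Import Defs.
From mathcomp Require Import all_boot all_order all_algebra.
From mathcomp Require Import all_classical all_reals all_analysis.
From mathcomp Require Import ring lra zify.

Import Order.TTheory GRing.Theory Num.Theory.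
Import numFieldNormedType.Exports.

Local Open Scope classical_set_scope.
Local Open Scope ring_scope.

Set Implicit Arguments.
Unset Strict Implicit.
Unset Printing Implicit Defensive.

(* To a sequence [s] of bits attach [q s], equal to 1/2 or 12/25 according to the
   first bit, and the point [tip s = q s (1 - tip (shift s))]. To have [f_(shift
   s)] as the renormalization of [f_s], let [f_s x = (1 - x) / q] on [[1 - q^2,
   1]] and [1 - f_s x = q^2 (1 - f_(shift s) (1 - x / q))] on [[0, q]].  This
   rescaling multiplies lengths by [q] and values by [q^2], hence preserves second
   derivatives, so a C^1 filling of the gap [[q, 1 - q^2]] yields a C^{1+Lip} map
   with quadratic tip at [tip s], for every [s]. The critical point of [R^n f_s]
   is [tip (shift^n s)]. The points [tip s] form the attractor of two contractions
   with disjoint images, a Cantor set, in which the tips of the shifts of a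
   sequence containing every finite word are dense. *)

(** * Functions with Lipschitz derivative on an interval *)

(* [d] is the derivative of [F] on [[u, v]], with Lipschitz constant [L]; the
   second-order form makes sense without limits, and passes to pointwise limits. *)
Definition C1Lip_on (R : realType) (L u v : R) (F d : R -> R) : Prop :=
  forall x y, u <= x <= v -> u <= y <= v ->
  `|d y - d x| <= L * `|y - x| /\
  `|F y - F x - d x * (y - x)| <= L * (y - x) ^+ 2.

Lemma C1Lip_on_ext (R : realType) (L u v : R) (F d G e : R -> R) :
  (forall x, u <= x <= v -> F x = G x) -> (forall x, u <= x <= v -> d x = e x) ->
  C1Lip_on L u v G e -> C1Lip_on L u v F d.
Proof. by move=> FG de GL x y Hx Hy; rewrite !FG // !de //; exact: GL. Qed.

Lemma C1Lip_on_le (R : realType) (L L' u v : R) (F d : R -> R) :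
  L <= L' -> C1Lip_on L u v F d -> C1Lip_on L' u v F d.
Proof.
move=> LL FL x y Hx Hy; have [H1 H2] := FL x y Hx Hy.
split; first by rewrite (le_trans H1) // ler_wpM2r.
by rewrite (le_trans H2) // ler_wpM2r // sqr_ge0.
Qed.

(** For [x <= v < y], put [a = v - x] and [b = y - v]. The remainders on the two sides of [v] and
    the change of slope from [x] to [v], acting over [b], add up to at most [L (a^2 + b^2 + a b)],
    which is below [L (a + b)^2]. Hence the constant [L] does not grow. The case [y <= v < x] is
    symmetric. *)
Lemma C1Lip_on_glue (R : realType) (L u v w : R) (F d : R -> R) :
  u <= v -> v <= w ->
  C1Lip_on L u v F d -> C1Lip_on L v w F d -> C1Lip_on L u w F d.
Proof.
move=> uv vw A B x y /andP[ux xw] /andP[uy yw].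
case: (leP x v) => xv; case: (leP y v) => yv.
- by apply: A; apply/andP.
- have [||A1 A2] := A x v; rewrite ?ux ?xv ?uv ?lexx //.
  have [||B1 B2] := B v y; rewrite ?(ltW yv) ?yw ?vw ?lexx //.
  have e1 : `|v - x| = v - x by rewrite ger0_norm // subr_ge0.
  have e2 : `|y - v| = y - v by rewrite ger0_norm // subr_ge0 ltW.
  have e3 : `|y - x| = y - x by rewrite ger0_norm // subr_ge0 (le_trans xv) // ltW.
  rewrite e1 in A1; rewrite e2 in B1; rewrite e3.
  move: A1 A2 B1 B2; rewrite !ler_norml => /andP[a1 a2] /andP[a3 a4] /andP[b1 b2] /andP[b3 b4].
  have yv0 : 0 <= y - v by lra.
  have vx0 : 0 <= v - x by lra.
  have L0 := mulr_ge0 yv0 vx0.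
  have m1 : (d v - d x) * (y - v) <= L * (v - x) * (y - v) by rewrite ler_wpM2r.
  have m2 : - (L * (v - x)) * (y - v) <= (d v - d x) * (y - v) by rewrite ler_wpM2r.
  have m0 : 0 <= L * (v - x) by lra.
  have m3 := mulr_ge0 m0 yv0.
  split; apply/andP; split; nra.
- have [||B1 B2] := B x v; rewrite ?(ltW xv) ?xw ?vw ?lexx //.
  have [||A1 A2] := A v y; rewrite ?yv ?uy ?uv ?lexx //.
  have e1 : `|v - x| = x - v by rewrite distrC ger0_norm // subr_ge0 ltW.
  have e2 : `|y - v| = v - y by rewrite distrC ger0_norm // subr_ge0.
  have e3 : `|y - x| = x - y by rewrite distrC ger0_norm // subr_ge0 (le_trans yv) // ltW.
  rewrite e1 in B1; rewrite e2 in A1; rewrite e3.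
  move: A1 A2 B1 B2; rewrite !ler_norml => /andP[a1 a2] /andP[a3 a4] /andP[b1 b2] /andP[b3 b4].
  have yv0 : 0 <= v - y by lra.
  have vx0 : 0 <= x - v by lra.
  have m1 : (d v - d x) * (v - y) <= L * (x - v) * (v - y) by rewrite ler_wpM2r.
  have m2 : - (L * (x - v)) * (v - y) <= (d v - d x) * (v - y) by rewrite ler_wpM2r.
  have m0 : 0 <= L * (x - v) by lra.
  have m3 := mulr_ge0 m0 yv0.
  split; apply/andP; split; nra.
- by apply: B; apply/andP; split=> //; exact: ltW.
Qed.

(** With [g = q^2] and [be = - 1 / q] the factor [|g| be^2] equals 1, so the rescaling attached to
    renormalization keeps the Lipschitz constant. *)
Lemma C1Lip_on_affine (R : realType) (L a b u v g al be : R) (F d : R -> R) :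
  C1Lip_on L a b F d -> (forall x, u <= x <= v -> a <= al + be * x <= b) ->
  C1Lip_on (`|g| * be ^+ 2 * L) u v (fun x => g * F (al + be * x))
    (fun x => g * be * d (al + be * x)).
Proof.
move=> FL H x y /H Hx /H Hy; have [H1 H2] := FL _ _ Hx Hy.
have e : al + be * y - (al + be * x) = be * (y - x) by ring.
rewrite e in H1 H2.
have -> : g * be * d (al + be * y) - g * be * d (al + be * x) =
   g * be * (d (al + be * y) - d (al + be * x)) by ring.
have -> : g * F (al + be * y) - g * F (al + be * x)
      - g * be * d (al + be * x) * (y - x) =
   g * (F (al + be * y) - F (al + be * x) - d (al + be * x) * (be * (y - x))) by ring.
split.
  rewrite normrM (le_trans (ler_wpM2l _ H1)) // normrM.
  rewrite (normrM be) -(real_normK (num_real be)) le_eqVlt.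
  by apply/orP; left; apply/eqP; ring.
rewrite normrM (le_trans (ler_wpM2l _ H2)) //.
by rewrite le_eqVlt; apply/orP; left; apply/eqP; ring.
Qed.

Lemma C1Lip_on_line (R : realType) (u v m k : R) :
  C1Lip_on 0 u v (fun x => m + k * x) (fun=> k).
Proof.
move=> x y _ _; rewrite subrr normr0 mul0r; split=> //.
by rewrite (_ : _ - _ = 0) ?normr0 ?mul0r //; ring.
Qed.

Lemma C1Lip_on_lim (R : realType) (L u v : R) (F d : nat -> R -> R) (G e : R -> R) :
  (forall x, u <= x <= v -> F k x @[k --> \oo] --> G x) ->
  (forall x, u <= x <= v -> d k x @[k --> \oo] --> e x) ->
  (forall k, C1Lip_on L u v (F k) (d k)) -> C1Lip_on L u v G e.
Proof.
move=> FG de FL x y Hx Hy; split.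
  apply: (@cvgr_to_le _ \oo _ _ (fun k => `|d k y - d k x|)).
    by apply: cvg_norm; apply: cvgB; exact: de.
  by apply: nearW => k; exact: (FL k x y Hx Hy).1.
apply: (@cvgr_to_le _ \oo _ _ (fun k => `|F k y - F k x - d k x * (y - x)|)).
  apply: cvg_norm; apply: cvgB; first by apply: cvgB; exact: FG.
  by apply: cvgM; [exact: de|exact: cvg_cst].
by apply: nearW => k; exact: (FL k x y Hx Hy).2.
Qed.

(** * Cubics in Bernstein form *)

(** The end values are [b0] and [b3], the end slopes [3 (b1 - b0)] and [3 (b3 - b2)]: the control
    values encode Hermite data at 0 and 1, and also control the range, the sign of the slope and the
    second derivative. *)
Definition bezier (R : realType) (b0 b1 b2 b3 t : R) : R :=
  b0 * (1 - t) ^+ 3 + 3 * b1 * t * (1 - t) ^+ 2 + 3 * b2 * t ^+ 2 * (1 - t)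
  + b3 * t ^+ 3.

Definition bezier' (R : realType) (b0 b1 b2 b3 t : R) : R :=
  3 * ((b1 - b0) * (1 - t) ^+ 2 + 2 * (b2 - b1) * t * (1 - t)
       + (b3 - b2) * t ^+ 2).

(** The slope increment divided by [y - x], and the remainder divided by [(y - x)^2], are
    nonnegative combinations of the two second differences of the control values, of total weight 6
    and 3 respectively. *)
Lemma C1Lip_on_bezier (R : realType) (b0 b1 b2 b3 M : R) :
  `|(b2 - b1) - (b1 - b0)| <= M -> `|(b3 - b2) - (b2 - b1)| <= M ->
  C1Lip_on (6 * M) 0 1 (bezier b0 b1 b2 b3) (bezier' b0 b1 b2 b3).
Proof.
set m1 := _ - _ - _ => h1; set m2 := _ - _ - _ => h2.
move=> x y /andP[x0 x1] /andP[y0 y1].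
have M0 : 0 <= M by rewrite (le_trans _ h1).
have comb a b : 0 <= a -> 0 <= b -> `|a * m1 + b * m2| <= (a + b) * M.
  move=> a0 b0'; rewrite (le_trans (ler_normD _ _)) // !normrM (ger0_norm a0) (ger0_norm b0') mulrDl.
  by rewrite lerD // ler_wpM2l.
have -> : bezier' b0 b1 b2 b3 y - bezier' b0 b1 b2 b3 x =
  3 * ((2 - x - y) * m1 + (x + y) * m2) * (y - x).
  by rewrite /bezier' /m1 /m2; ring.
have -> : bezier b0 b1 b2 b3 y - bezier b0 b1 b2 b3 x
    - bezier' b0 b1 b2 b3 x * (y - x) =
  ((3 - (2 * x + y)) * m1 + (2 * x + y) * m2) * (y - x) ^+ 2.
  by rewrite /bezier /bezier' /m1 /m2; ring.
rewrite normrM (normrM _ ((y - x) ^+ 2)) (ger0_norm (sqr_ge0 _)) normrM ger0_norm //.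
split.
  apply: ler_wpM2r => //; have := comb (2 - x - y) (x + y); lra.
apply: ler_wpM2r; first exact: sqr_ge0.
have := comb (3 - (2 * x + y)) (2 * x + y); lra.
Qed.

(** The Bernstein weights are nonnegative with sum 1, so the value is a convex combination of the
    control values. *)
Lemma bezier_itv (R : realType) (b0 b1 b2 b3 a b t : R) :
  a <= b0 <= b -> a <= b1 <= b -> a <= b2 <= b -> a <= b3 <= b -> 0 <= t <= 1 ->
  a <= bezier b0 b1 b2 b3 t <= b.
Proof.
move=> /andP[? ?] /andP[? ?] /andP[? ?] /andP[? ?] /andP[t0 t1].
have s0 : 0 <= 1 - t by lra.
have w0 := exprn_ge0 3 s0.
have w1 := mulr_ge0 t0 (exprn_ge0 2 s0).
have w2 := mulr_ge0 (exprn_ge0 2 t0) s0.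
have w3 := exprn_ge0 3 t0.
have e : (1 - t) ^+ 3 + 3 * (t * (1 - t) ^+ 2) + 3 * (t ^+ 2 * (1 - t)) + t ^+ 3 = 1.
  by ring.
have E : bezier b0 b1 b2 b3 t = b0 * (1 - t) ^+ 3 + 3 * b1 * (t * (1 - t) ^+ 2)
   + 3 * b2 * (t ^+ 2 * (1 - t)) + b3 * t ^+ 3 by rewrite /bezier; ring.
rewrite E; move: w0 w1 w2 w3 e {E}.
move: ((1 - t) ^+ 3) (t * (1 - t) ^+ 2) (t ^+ 2 * (1 - t)) (t ^+ 3) => W0 W1 W2 W3 *.
apply/andP; split; nra.
Qed.

Lemma bezier'_gt0 (R : realType) (b0 b1 b2 b3 t : R) :
  b0 < b1 -> b1 < b2 -> b2 < b3 -> 0 <= t <= 1 -> 0 < bezier' b0 b1 b2 b3 t.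
Proof.
move=> h0 h1 h2 /andP[t0 t1]; rewrite /bezier'.
have w1 : 0 <= (b2 - b1) * (t * (1 - t)).
  by rewrite !mulr_ge0 ?subr_ge0 // ltW.
have [t2|t2] := ltP t 1.
  have w0 : 0 < (b1 - b0) * (1 - t) ^+ 2.
    by rewrite mulr_gt0 ?exprn_gt0 ?subr_gt0.
  have w2 : 0 <= (b3 - b2) * t ^+ 2.
    by rewrite mulr_ge0 ?sqr_ge0 // subr_ge0 ltW.
  nra.
have -> : t = 1 by apply/eqP; rewrite eq_le t1.
nra.
Qed.

(** * Comparison with [deriv01] and continuity *)

Lemma unit_intervalE (R : realType) (x : R) : unit_interval x <-> 0 <= x <= 1.
Proof. by rewrite /unit_interval /= in_itv. Qed.

(** Properness makes the limit that defines [deriv01] unique. A nearby point of [0, 1] is taken on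
    the side with room: to the right if [x <= 1/2], to the left otherwise. *)
Lemma unit_interval_dnbhs_proper (R : realType) (x : R) :
  unit_interval x -> ProperFilter (within (@unit_interval R) x^').
Proof.
move=> /unit_intervalE /andP[x0 x1]; split; last exact: within_filter.
rewrite /within /= /dnbhs /within /= => /nbhs_ballP[e /= e0 H].
have [x2|x2] := leP x (1/2).
  pose y := x + Num.min (e / 2) (1 / 2).
  have m0 : 0 < Num.min (e / 2) (1 / 2) by rewrite lt_min; apply/andP; split; lra.
  have m1 : Num.min (e / 2) (1 / 2) <= e / 2 by rewrite ge_min lexx.
  have m2 : Num.min (e / 2) (1 / 2) <= 1 / 2 by rewrite ge_min lexx orbT.
  apply: (H y); last by apply/unit_intervalE; rewrite /y; apply/andP; split; lra.
    by rewrite -ball_normE /= /y opprD addNKr normrN gtr0_norm //; lra.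
  by rewrite /y -subr_eq0 addrAC subrr add0r gt_eqF.
pose y := x - Num.min (e / 2) (1 / 2).
have m0 : 0 < Num.min (e / 2) (1 / 2) by rewrite lt_min; apply/andP; split; lra.
have m1 : Num.min (e / 2) (1 / 2) <= e / 2 by rewrite ge_min lexx.
have m2 : Num.min (e / 2) (1 / 2) <= 1 / 2 by rewrite ge_min lexx orbT.
apply: (H y); last by apply/unit_intervalE; rewrite /y; apply/andP; split; lra.
  by rewrite -ball_normE /= /y opprB addrC subrK gtr0_norm //; lra.
by rewrite /y -subr_eq0 addrAC subrr add0r oppr_eq0 gt_eqF.
Qed.

(** Dividing the second-order estimate by [y - x] leaves an error of at most [|L| |y - x|];
    [|L| + 1] serves as a positive bound of [L]. *)
Lemma C1Lip_on_diff_quot (R : realType) (L : R) (F d : R -> R) (x : R) :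
  C1Lip_on L 0 1 F d -> unit_interval x ->
  diff_quot F x y @[y --> within (@unit_interval R) x^'] --> d x.
Proof.
move=> FL Ix; apply/cvgrPdist_le => e e0.
have M0 : 0 < `|L| + 1 by rewrite (lt_le_trans ltr01) // lerDr.
have He : 0 < e / (`|L| + 1) by rewrite divr_gt0.
suff : \forall y \near x, y != x -> unit_interval y ->
    `|d x - diff_quot F x y| <= e by [].
near=> y => yx Iy.
have [_ H] := FL x y ((unit_intervalE x).1 Ix) ((unit_intervalE y).1 Iy).
have yx0 : y - x != 0 by rewrite subr_eq0.
rewrite /diff_quot distrC.
have -> : (F y - F x) / (y - x) - d x = (F y - F x - d x * (y - x)) / (y - x).
  by field.
rewrite normrM normfV ler_pdivrMr ?normr_gt0 //.
rewrite (le_trans H) // -(real_normK (num_real (y - x))) expr2 mulrA ler_wpM2r //.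
have : `|y - x| <= e / (`|L| + 1).
  rewrite distrC; near: y.
  apply/nbhs_ballP; exists (e / (`|L| + 1)) => // z.
  by rewrite -ball_normE => /ltW.
rewrite ler_pdivlMr // => h; apply: le_trans h.
by rewrite mulrC ler_wpM2l // (le_trans (ler_norm L)) // lerDl.
Unshelve. all: by end_near. Qed.

Lemma C1Lip_on_deriv01 (R : realType) (L : R) (F d : R -> R) (x : R) :
  C1Lip_on L 0 1 F d -> unit_interval x -> derivable01 F x /\ deriv01 F x = d x.
Proof.
move=> FL Ix; have h := C1Lip_on_diff_quot FL Ix.
split; first by apply/cvg_ex; exists (d x).
by apply: cvg_lim; [exact: Rhausdorff|exact: unit_interval_dnbhs_proper|].
Qed.

Lemma lipschitz_within_continuous (R : realType) (L : R) (A : set R) (f : R -> R) :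
  (forall x y, A x -> A y -> `|f y - f x| <= L * `|y - x|) ->
  {within A, continuous f}.
Proof.
move=> H; apply/subspace_continuousP => x Ax; apply/cvgrPdist_le => e e0.
have M0 : 0 < `|L| + 1 by rewrite (lt_le_trans ltr01) // lerDr.
have He : 0 < e / (`|L| + 1) by rewrite divr_gt0.
suff : \forall y \near x, A y -> `|f x - f y| <= e by [].
near=> y => Ay.
rewrite distrC (le_trans (H _ _ Ax Ay)) //.
have : `|y - x| <= e / (`|L| + 1).
  rewrite distrC; near: y.
  apply/nbhs_ballP; exists (e / (`|L| + 1)) => // z.
  by rewrite -ball_normE => /ltW.
rewrite ler_pdivlMr // => h; apply: le_trans h.
by rewrite mulrC ler_wpM2l // (le_trans (ler_norm L)) // lerDl.
Unshelve. all: by end_near. Qed.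

Lemma C1Lip_on_C1Lip_01 (R : realType) (L : R) (F d : R -> R) :
  C1Lip_on L 0 1 F d -> C1Lip_01 F.
Proof.
move=> FL.
have Lip x y : unit_interval x -> unit_interval y ->
    `|deriv01 F y - deriv01 F x| <= L * `|y - x|.
  move=> Ix Iy; rewrite (C1Lip_on_deriv01 FL Ix).2.
  rewrite (C1Lip_on_deriv01 FL Iy).2.
  by have [] := FL x y ((unit_intervalE x).1 Ix) ((unit_intervalE y).1 Iy).
split; first split.
- by move=> x Ix; exact: (C1Lip_on_deriv01 FL Ix).1.
- exact: lipschitz_within_continuous Lip.
- apply: (@klipschitzW _ _ _ L).
    apply: (@globally_properfilter _ _ (0, 0)).
    by split; apply/unit_intervalE; rewrite lexx ler01.
  by move=> [x y] /= [Ix Iy]; exact: Lip.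
Qed.

Lemma C1Lip_on_continuous (R : realType) (L u v : R) (F d : R -> R) :
  C1Lip_on L u v F d -> {within `[u, v], continuous F}.
Proof.
move=> FL; have [uv|vu] := leP u v; last first.
  by rewrite set_itv_ge ?bnd_simp -?ltNge //; exact: continuous_subspace0.
(* The first two terms bound the slope on the whole interval; the last one absorbs the quadratic
   remainder. *)
apply: (@lipschitz_within_continuous _ (`|d u| + L * (v - u) + L * (v - u))).
move=> x y /=; rewrite !in_itv /= => Ix Iy.
have Iu : u <= u <= v by rewrite lexx.
have L0 : 0 <= L * (v - u).
  have Iv : u <= v <= v by rewrite lexx uv.
  have [h _] := FL u v Iu Iv.
  by move: h; rewrite (ger0_norm (_ : 0 <= v - u)) ?subr_ge0 //; exact: le_trans.
have [h1 h2] := FL x y Ix Iy; have [h3 _] := FL u x Iu Ix.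
have -> : F y - F x = (F y - F x - d x * (y - x)) + d x * (y - x) by ring.
rewrite (le_trans (ler_normD _ _)) // mulrDl addrC lerD //.
  rewrite normrM ler_wpM2r //.
  have -> : d x = d u + (d x - d u) by ring.
  rewrite (le_trans (ler_normD _ _)) // lerD2l (le_trans h3) //.
  have [uv0|uv0] := eqVneq u v.
    by move: Ix; rewrite -uv0 => /le_anti ->; rewrite !subrr normr0 mulr0.
  have uv1 : 0 < v - u by rewrite subr_gt0 lt_neqAle uv0.
  have {}L0 : 0 <= L by rewrite pmulr_lge0 in L0.
  by rewrite ler_wpM2l // ler_norml; lra.
rewrite (le_trans h2) // -(real_normK (num_real (y - x))) expr2 mulrA ler_wpM2r //.
have [uv0|uv0] := eqVneq u v.
  move: Ix Iy; rewrite -uv0 => /le_anti -> /le_anti <-; first by rewrite !subrr normr0 mulr0.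
have uv1 : 0 < v - u by rewrite subr_gt0 lt_neqAle uv0.
have {}L0 : 0 <= L by rewrite pmulr_lge0 in L0.
by rewrite ler_wpM2l // ler_norml; lra.
Qed.

(** * Convergence at rate 1/2 *)

Lemma half_pow_cvg0 (R : realType) (C : R) : (C / 2 ^+ k) @[k --> \oo] --> (0 : R).
Proof.
have := @cvg_geometric R C (2^-1).
rewrite ger0_norm ?invr_ge0 // invf_lt1 ?ltr1n // => /(_ isT).
by apply: cvg_trans; apply: near_eq_cvg; apply: nearW => k; rewrite /geometric /= exprVn.
Qed.

Lemma half_pow_lt (R : realType) (C e : R) : 0 < e -> exists k, `|C / 2 ^+ k| < e.
Proof.
move=> e0; have /cvgrPdist_lt /(_ e e0) [k _ H] := half_pow_cvg0 C.
by exists k; have := H k (leqnn k); rewrite /= sub0r normrN.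
Qed.

Lemma cvg_half_pow_steps (R : realType) (C : R) (u : nat -> R) :
  (forall k, `|u k.+1 - u k| <= C / 2 ^+ k) -> cvg (u @ \oo).
Proof.
move=> H; have C0 : 0 <= C by have := H 0%N; rewrite expr0 divr1; apply: le_trans.
apply/cvg_ex.
have -> : u = (fun n => u 0%N + series (fun k => u k.+1 - u k) n).
  apply/funext => n; rewrite /series /= telescope_sumr // addrC subrK //.
suff /cvg_ex[l hl] : cvgn (series (fun k => u k.+1 - u k)).
  by exists (u 0%N + l); apply: cvgD => //; exact: cvg_cst.
apply: normed_cvg; apply: (@series_le_cvg _ _ (geometric C 2^-1)).
- by move=> n /=; exact: normr_ge0.
- by move=> n /=; rewrite mulr_ge0 // exprn_ge0.
- by move=> n /=; rewrite exprVn; exact: H.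
- apply: is_cvg_geometric_series.
  by rewrite ger0_norm ?invr_ge0 // invf_lt1 ?ltr1n.
Qed.

(** * The tips and the Cantor set they form *)

Definition shift_seq (s : nat -> bool) (n : nat) : bool := s n.+1.

Definition scaling (R : realType) (s : nat -> bool) : R :=
  if s 0%N then 1 / 2 else 12 / 25.

(** The starting value 1/3, the fixed point of [x |-> (1 - x) / 2], lies in the interval that both
    contractions preserve, so the bounds hold from [k = 0] on. *)
Fixpoint tip_approx (R : realType) (k : nat) (s : nat -> bool) : R :=
  if k is k'.+1 then scaling R s * (1 - tip_approx R k' (shift_seq s)) else 1 / 3.

Definition tip (R : realType) (s : nat -> bool) : R :=
  lim (tip_approx R k s @[k --> \oo]).

Lemma scaling_itv (R : realType) s : 12 / 25 <= scaling R s <= 1 / 2.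
Proof. by rewrite /scaling; case: (s 0%N); lra. Qed.

Lemma scaling_gt0 (R : realType) s : 0 < scaling R s.
Proof. by have := scaling_itv R s; lra. Qed.

Lemma scaling_neq0 (R : realType) s : scaling R s != 0.
Proof. exact: lt0r_neq0 (scaling_gt0 R s). Qed.

Lemma scaling_le_half (R : realType) s : scaling R s <= 1 / 2.
Proof. by have := scaling_itv R s; lra. Qed.

Lemma half_scaling_bound (R : realType) s (k : nat) (C x : R) :
  0 <= x -> x <= C / 2 ^+ k -> scaling R s * x <= C / 2 ^+ k.+1.
Proof.
move=> x0 h; have -> : C / 2 ^+ k.+1 = 1 / 2 * (C / 2 ^+ k).
  by rewrite exprS invfM; ring.
by rewrite ler_pM // ?scaling_le_half // ltW // scaling_gt0.
Qed.

(* 6/19 and 13/38 are the endpoints of the interval spanned by the attractor of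
   the two contractions [x |-> r (1 - x)], [r = 12/25, 1/2]. *)
Lemma tip_approx_itv (R : realType) k s : 6 / 19 <= tip_approx R k s <= 13 / 38.
Proof.
elim: k s => [|k IH] s /=; first by lra.
by rewrite /scaling; case: (s 0%N); have := IH (shift_seq s); lra.
Qed.

Lemma tip_approx_step (R : realType) k s :
  `|tip_approx R k.+1 s - tip_approx R k s| <= 1 / 2 ^+ k.
Proof.
elim: k s => [|k IH] s.
  have := tip_approx_itv R 1 s; have := tip_approx_itv R 0 s.
  by rewrite expr0 ler_norml; lra.
have -> : tip_approx R k.+2 s - tip_approx R k.+1 s =
    - (scaling R s * (tip_approx R k.+1 (shift_seq s) - tip_approx R k (shift_seq s))).
  by rewrite /=; ring.
by rewrite normrN normrM (gtr0_norm (scaling_gt0 _ _)) half_scaling_bound.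
Qed.

Lemma tip_approx_cvg (R : realType) s : tip_approx R k s @[k --> \oo] --> tip R s.
Proof. exact: (cvg_half_pow_steps (fun k => tip_approx_step R k s)). Qed.

Lemma tipE (R : realType) s : tip R s = scaling R s * (1 - tip R (shift_seq s)).
Proof.
apply: (@cvg_unique _ _ (tip_approx R k.+1 s @[k --> \oo])) => //=.
  by rewrite (cvg_shiftS (fun k => tip_approx R k s)); exact: tip_approx_cvg.
apply: cvgM; first exact: cvg_cst.
by apply: cvgB; [exact: cvg_cst|exact: tip_approx_cvg].
Qed.

Lemma tip_itv (R : realType) s : 6 / 19 <= tip R s <= 13 / 38.
Proof.
have h k := andP (tip_approx_itv R k s); apply/andP; split.
  apply: (@cvgr_to_ge _ \oo _ _ (fun k => tip_approx R k s)).
    exact: tip_approx_cvg.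
  by apply: nearW => k; exact: (h k).1.
apply: (@cvgr_to_le _ \oo _ _ (fun k => tip_approx R k s)).
  exact: tip_approx_cvg.
by apply: nearW => k; exact: (h k).2.
Qed.

(** Each common letter applies the same contraction, of ratio at most 1/2, to both tips. Continuity
    of [tip], perfectness and the density of the shifted tips all rest on this estimate. *)
Lemma tip_dist (R : realType) k s t :
  (forall i, (i < k)%N -> s i = t i) -> `|tip R s - tip R t| <= 1 / 2 ^+ k.
Proof.
elim: k s t => [|k IH] s t st.
  have := tip_itv R s; have := tip_itv R t; rewrite expr0 ler_norml; lra.
rewrite (tipE R s) (tipE R t) (_ : scaling R t = scaling R s); last by rewrite /scaling st.
rewrite -mulrBr normrM (gtr0_norm (scaling_gt0 _ _)) half_scaling_bound //.
have -> : 1 - tip R (shift_seq s) - (1 - tip R (shift_seq t)) =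
  - (tip R (shift_seq s) - tip R (shift_seq t)) by ring.
rewrite normrN.
by apply: IH => i ik; exact: st.
Qed.

(** Here [25/76 = 1/2 (1 - 13/38)] and [156/475 = 12/25 (1 - 6/19)]. As [156/475 < 25/76], the
    images of the two contractions are disjoint. *)
Lemma tip_head (R : realType) s :
  if s 0%N then 25 / 76 <= tip R s else tip R s <= 156 / 475.
Proof.
rewrite tipE /scaling; have := tip_itv R (shift_seq s); case: (s 0%N); lra.
Qed.

(** If the first letters differ, the gap between the two images separates the tips; otherwise a gap
    for the shifts is carried back by the common contraction, which reverses the order. This gives
    both the injectivity of [tip] and the total disconnectedness of its range. *)
Lemma tip_gap (R : realType) n s t : s n != t n ->
  exists z, ~ range (tip R) z /\ (tip R s < z < tip R t \/ tip R t < z < tip R s).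
Proof.
have sep u v : u 0%N != v 0%N ->
    exists z, ~ range (tip R) z /\ (tip R u < z < tip R v \/ tip R v < z < tip R u).
  (* 156/475 < 3287/10000 < 25/76 *)
  move=> H; exists (3287 / 10000); split.
    move=> [x _ hx]; have := tip_head R x; rewrite hx; case: (x 0%N); lra.
  have := tip_head R u; have := tip_head R v.
  by move: H; case: (u 0%N); case: (v 0%N) => // _ h1 h2; [right|left]; lra.
elim: n s t => [|n IH] s t st; first exact: sep.
have [st0|st0] := eqVneq (s 0%N) (t 0%N); last exact: sep.
have [z [nz hz]] := IH (shift_seq s) (shift_seq t) st.
have rE : scaling R t = scaling R s by rewrite /scaling st0.
have r0 := scaling_gt0 R s.
exists (scaling R s * (1 - z)); split; last first.
  rewrite (tipE R s) (tipE R t) rE !ltr_pM2l // !ltrD2l !ltrN2.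
  by case: hz => /andP[-> ->]; [right|left].
move=> [u _ hu].
have [us|us] := eqVneq (u 0%N) (s 0%N).
  apply: nz; exists (shift_seq u) => //; move: hu; rewrite tipE.
  rewrite (_ : scaling R u = scaling R s); last by rewrite /scaling us.
  by move/(mulfI (lt0r_neq0 r0)) => /addrI /oppr_inj.
(* A tip with the other first letter lies across the central gap, while the carried point stays
   between two tips that begin with the letter of [s]. *)
have := tip_head R u; rewrite hu.
have := tip_itv R (shift_seq s); have := tip_itv R (shift_seq t).
by move: us; rewrite /scaling; case: (s 0%N); case: (u 0%N) => //= _; case: hz; lra.
Qed.

Lemma tip_continuous (R : realType) : continuous (tip R : cantor_space -> R).
Proof.
move=> s; apply/cvgrPdist_lt => e e0; have [k hk] := half_pow_lt 1 e0.
(* In the product topology the sequences that share a given finite prefix with [s] form a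
   neighbourhood of [s]. *)
have : \forall t \near (s : cantor_space), forall i, (i < k)%N -> s i = t i.
  elim: k {hk} => [|k IH]; first by apply: filterE => t i.
  have := @proj_continuous nat (fun=> bool) k s [set b | b = s k].
  move=> /(_ (discrete_set1 _)) Hk.
  apply: filterS2 IH Hk => t H1 H2 i; rewrite ltnS leq_eqVlt => /orP[/eqP ->|/H1 //].
  exact/esym/H2.
apply: filterS => t /(tip_dist R) h; apply: le_lt_trans h _.
by rewrite (le_lt_trans (ler_norm _) hk).
Qed.

Lemma range_tip_cantor (R : realType) : cantor_set (range (tip R)).
Proof.
have cK : compact (range (tip R)).
  apply: (@continuous_compact cantor_space); last exact: cantor_space_compact.
  by apply: continuous_subspaceT => s; exact: tip_continuous.
have clK : closed (range (tip R)) by apply: compact_closed => //; exact: Rhausdorff.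
split=> //.
- by exists (tip R (fun=> true)); exists (fun=> true).
- split=> //; apply/seteqP; split.
    by move=> x /subset_limit_point; rewrite -(closure_id _).1.
  move=> _ [s _ <-] U /nbhs_ballP[e /= e0 eU].
  have [k hk] := half_pow_lt 1 e0.
  (* Flipping the single bit [k] moves the tip by at most [1 / 2^k], and moves it indeed, by
     [tip_gap]. *)
  pose t i := if i == k then ~~ s k else s i.
  exists (tip R t); split; [|by exists t|].
    apply/eqP => ts; have [|z [_ hz]] := @tip_gap R k s t.
      by rewrite /t eqxx; case: (s k).
    by move: hz; rewrite ts; case; lra.
  apply: eU; rewrite -ball_normE /=; apply: le_lt_trans (le_lt_trans (ler_norm _) hk).
  by apply: tip_dist => i ik; rewrite /t ltn_eqF.
- move=> _ [s _ <-]; apply/seteqP; split; last first.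
    move=> x /= ->; exists [set tip R s] => //; split=> //; last exact: connected1.
    by move=> y ->; exists s.
  (* A connected part of the range is an interval; with two distinct tips it would also contain a
     point of a gap between them. *)
  move=> x [C [Cs CK /connected_intervalP iC] Cx].
  have [t _ tx] := CK _ Cx; rewrite /= -tx in Cx *.
  have [->//|/eqP st] := pselect (t = s).
  have [n stn] : exists n, s n != t n.
    apply: contrapT => H; move/eqP: st; apply; apply/funext => n.
    by apply/eqP; rewrite eq_sym; apply: contrapT => /negP h; apply: H; exists n.
  have [z [nz hz]] := @tip_gap R n s t stn.
  case: nz; apply: CK; case: hz => /andP[/ltW h1 /ltW h2].
    by apply: (iC _ _ Cs Cx); rewrite h1.
  by apply: (iC _ _ Cx Cs); rewrite h1.
Qed.

(** * A sequence containing every finite word *)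

(** The prescribed bits are the lowest ones and are added one at a time by [V |-> s 0 + 2 V]. The
    digits of [B] sit above them, which makes [V] as large as desired. *)
Lemma binary_word k (s : nat -> bool) (B : nat) :
  exists V, (B <= V)%N /\ forall i, (i < k)%N -> odd (V %/ 2 ^ i) = s i.
Proof.
elim: k s => [|k IH] s; first by exists B.
have [V [BV HV]] := IH (shift_seq s); exists (s 0%N + V.*2)%N; split; first by lia.
case=> [|i] ik; first by rewrite expn0 divn1 oddD odd_double addbF oddb.
by rewrite -[s i.+1]/(shift_seq s i) expnS divnMA -(HV i) // divn2 halfD odd_double andbF doubleK; case: (s 0%N).
Qed.

(* The block of positions [2 ^ V, 2 ^ V.+1) spells the binary expansion of [V]. *)
Definition universal_seq (n : nat) : bool :=
  let V := trunc_log 2 n in odd (V %/ 2 ^ (n - 2 ^ V)).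

Lemma universal_seqP (s : nat -> bool) k :
  exists n, forall i, (i < k)%N -> universal_seq (n + i) = s i.
Proof.
(* Asking for [k <= V] keeps the [k] positions from [2^V] on inside the block of [V], since
   [V < 2^V]. *)
have [V [kV HV]] := binary_word k s k; exists (2 ^ V)%N => i ik.
rewrite /universal_seq (_ : trunc_log 2 (2 ^ V + i) = V) ?addKn ?HV //.
apply: trunc_log_eq => //; rewrite leq_addr expnS mul2n -addnn ltn_add2l /=.
exact: leq_trans (leq_trans ik kV) (ltnW (ltn_expl V (leqnn 2))).
Qed.

Lemma iter_shift_seq n (s : nat -> bool) i : iter n shift_seq s i = s (n + i)%N.
Proof. by elim: n i => [//|n IH] i; rewrite iterS /shift_seq IH addnS. Qed.

(** * Self-similar families of functions *)

(** Picard iteration, started at [g0], for the equation [phi_s x = m s * phi_(shift s) (1 - x / q)]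
    on [0, q], with [phi_s = g s] beyond [q]. The map [x |-> 1 - x / q] is the orientation reversing
    rescaling of [0, q] onto [0, 1]. Both the function and its derivative are obtained in this way,
    with different multipliers [m]. *)
Fixpoint selfsim_approx (R : realType) (m : (nat -> bool) -> R)
    (g0 g : (nat -> bool) -> R -> R) (k : nat) (s : nat -> bool) (x : R) : R :=
  if k is k'.+1 then
    if x <= scaling R s then
      m s * selfsim_approx m g0 g k' (shift_seq s) (1 - x / scaling R s)
    else g s x
  else g0 s x.

Definition selfsim (R : realType) (m : (nat -> bool) -> R)
    (g0 g : (nat -> bool) -> R -> R) (s : nat -> bool) (x : R) : R :=
  lim (selfsim_approx m g0 g k s x @[k --> \oo]).

Lemma rescale_itv (R : realType) s (x : R) :
  0 <= x <= scaling R s -> 0 <= 1 - x / scaling R s <= 1.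
Proof.
have q0 := scaling_gt0 R s; move=> /andP[x0 xq].
by rewrite subr_ge0 ler_pdivrMr // mul1r xq lerBlDr lerDl divr_ge0 // ltW.
Qed.

Lemma tip_le_scaling (R : realType) s : 0 <= tip R s <= scaling R s.
Proof. by have := scaling_itv R s; have := tip_itv R s; lra. Qed.

Lemma rescale_tip (R : realType) s : 1 - tip R s / scaling R s = tip R (shift_seq s).
Proof. by rewrite (tipE R s); field; exact: lt0r_neq0 (scaling_gt0 R s). Qed.

Section SelfSimilar.
Context (R : realType) (m : (nat -> bool) -> R) (g0 g : (nat -> bool) -> R -> R) (C : R).
Context (m_half : forall s, `|m s| <= 1 / 2)
  (g0_bound : forall s x, 0 <= x <= 1 -> `|g0 s x| <= C)
  (g_bound : forall s x, scaling R s < x -> x <= 1 -> `|g s x| <= C).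

Lemma selfsim_approx_bound k s x : 0 <= x <= 1 -> `|selfsim_approx m g0 g k s x| <= C.
Proof.
elim: k s x => [|k IH] s x Ix /=; first exact: g0_bound.
have C0 : 0 <= C by apply: le_trans (g0_bound s Ix).
case: (leP x (scaling R s)) => xq; last by apply: g_bound => //; case/andP: Ix.
have h : `|selfsim_approx m g0 g k (shift_seq s) (1 - x / scaling R s)| <= C.
  by apply: IH; apply: rescale_itv; rewrite xq andbT; case/andP: Ix.
rewrite normrM (le_trans (ler_pM _ _ (m_half s) h)) //; lra.
Qed.

(** On [0, q] the multiplier halves the difference inherited from the previous level; beyond [q] two
    successive approximations coincide once [k] is positive. *)
Lemma selfsim_approx_step k s x : 0 <= x <= 1 ->
  `|selfsim_approx m g0 g k.+1 s x - selfsim_approx m g0 g k s x| <= 2 * C / 2 ^+ k.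
Proof.
elim: k s x => [|k IH] s x Ix.
  rewrite expr0 divr1 (le_trans (ler_normB _ _)) // [2 * C]mulr_natl mulr2n.
  by rewrite lerD // selfsim_approx_bound.
have C0 : 0 <= C by apply: le_trans (g0_bound s Ix).
rewrite -[selfsim_approx _ _ _ k.+2 s x]/(if _ then _ else _).
rewrite -[selfsim_approx _ _ _ k.+1 s x]/(if _ then _ else _).
case: (leP x (scaling R s)) => xq; last by rewrite subrr normr0 divr_ge0 ?exprn_ge0 ?mulr_ge0.
rewrite -mulrBr normrM.
have -> : 2 * C / 2 ^+ k.+1 = 1 / 2 * (2 * C / 2 ^+ k) by rewrite exprS invfM; ring.
apply: ler_pM => //; apply: IH.
by apply: rescale_itv; rewrite xq andbT; case/andP: Ix.
Qed.

Lemma selfsim_cvg s x : 0 <= x <= 1 ->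
  selfsim_approx m g0 g k s x @[k --> \oo] --> selfsim m g0 g s x.
Proof.
move=> Ix; apply: (@cvg_half_pow_steps _ (2 * C)) => k.
exact: selfsim_approx_step.
Qed.

Lemma selfsim_in s x : 0 <= x <= scaling R s ->
  selfsim m g0 g s x = m s * selfsim m g0 g (shift_seq s) (1 - x / scaling R s).
Proof.
move=> /andP[x0 xq]; have x1 : x <= 1 by have := scaling_itv R s; lra.
apply: (@cvg_unique _ _ (selfsim_approx m g0 g k.+1 s x @[k --> \oo])) => //=.
  rewrite (cvg_shiftS (fun k => selfsim_approx m g0 g k s x)).
  by apply: selfsim_cvg; rewrite x0.
rewrite xq; apply: cvgM; first exact: cvg_cst.
by apply: selfsim_cvg; apply: rescale_itv; rewrite x0.
Qed.

Lemma selfsim_out s x : scaling R s < x -> selfsim m g0 g s x = g s x.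
Proof.
move=> xq; apply: cvg_lim => //.
rewrite -(cvg_shiftS (fun k => selfsim_approx m g0 g k s x)) /=.
by rewrite leNgt xq; exact: cvg_cst.
Qed.

(** Rescaling sends the tip of [s] to the tip of its shift, so the tip never leaves [0, q], and
    every level costs a factor of at most 1/2. *)
Lemma selfsim_tip s : selfsim m g0 g s (tip R s) = 0.
Proof.
have bnd k : forall s, `|selfsim m g0 g s (tip R s)| <= C / 2 ^+ k.
  elim: k => [|k IH] {}s.
    rewrite expr0 divr1; have It : 0 <= tip R s <= 1 by have := tip_itv R s; lra.
    apply: (@cvgr_to_le _ \oo _ _ (fun k => `|selfsim_approx m g0 g k s (tip R s)|)).
      by apply: cvg_norm; exact: selfsim_cvg.
    by apply: nearW => k; exact: selfsim_approx_bound.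
  rewrite selfsim_in ?tip_le_scaling // rescale_tip normrM.
  have -> : C / 2 ^+ k.+1 = 1 / 2 * (C / 2 ^+ k) by rewrite exprS invfM; ring.
  exact: ler_pM.
apply/eqP/negP => /negP; rewrite -normr_gt0 => /(half_pow_lt C)[k].
by rewrite ltNge (le_trans (bnd k s)) // ler_norm.
Qed.
End SelfSimilar.

(** Rescaling multiplies the distance to the tip by [1 / q >= 2], so each point other than the tip
    leaves [0, q] after finitely many steps. Properties of the limit functions can thus be proved by
    induction on the exit time. *)
Lemma tip_exit_ind (R : realType) (P : (nat -> bool) -> R -> Prop) :
  (forall s, P s (tip R s)) -> (forall s x, scaling R s < x -> x <= 1 -> P s x) ->
  (forall s x, 0 <= x <= scaling R s -> P (shift_seq s) (1 - x / scaling R s) -> P s x) ->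
  forall s x, 0 <= x <= 1 -> P s x.
Proof.
move=> Ptip Pout Pin s x Ix; have [->//|xt] := eqVneq x (tip R s).
have {xt} [k hk] : exists k, 1 / 2 ^+ k < `|x - tip R s|.
  have [|k hk] := @half_pow_lt R 1 `|x - tip R s|; first by rewrite normr_gt0 subr_eq0.
  by exists k; apply: le_lt_trans hk; exact: ler_norm.
elim: k s x Ix hk => [|k IH] s x /andP[x0 x1].
  have : `|x - tip R s| <= 1 by have := tip_itv R s; rewrite ler_norml; lra.
  by rewrite expr0; lra.
move=> hk; have [xq|xq] := leP x (scaling R s); last exact: Pout.
have Iq : 0 <= x <= scaling R s by rewrite x0.
apply: Pin => //; apply: IH; first exact: rescale_itv.
have q0 := scaling_gt0 R s.
rewrite -rescale_tip (_ : _ - _ = (tip R s - x) / scaling R s); last by field; exact: lt0r_neq0.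
rewrite normrM normfV (gtr0_norm q0) distrC ltr_pdivlMr // mulrC.
by apply: le_lt_trans hk; exact: half_scaling_bound.
Qed.

(** * The filling of the gap and the initial cubic *)

(* On [[q, 1 - q ^ 2]] a cubic, on [[1 - q ^ 2, 1]] affine with value 1 at 1.  The
   control values of the cubic are those of the C^1 interpolation between the
   affine piece and the self-similar piece on [[0, q]]; [w] is its width. *)
Definition outer_coef (R : realType) (s : nat -> bool) : R * R * R * R :=
  let q := scaling R s in let q1 := scaling R (shift_seq s) in
  let q2 := scaling R (shift_seq (shift_seq s)) in
  let w := 1 - q ^+ 2 - q in
  (q ^+ 2 * q1 ^+ 2, q ^+ 2 * q1 ^+ 2 + w * q * q1 / q2 / 3,
   1 - q - w / q / 3, 1 - q).

Definition outer (R : realType) (s : nat -> bool) (x : R) : R :=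
  let q := scaling R s in
  let: (b0, b1, b2, b3) := outer_coef R s in
  if x <= 1 - q ^+ 2 then bezier b0 b1 b2 b3 ((x - q) / (1 - q ^+ 2 - q))
  else 1 - (1 - x) / q.

Definition outer' (R : realType) (s : nat -> bool) (x : R) : R :=
  let q := scaling R s in
  let: (b0, b1, b2, b3) := outer_coef R s in
  if x <= 1 - q ^+ 2 then
    bezier' b0 b1 b2 b3 ((x - q) / (1 - q ^+ 2 - q)) / (1 - q ^+ 2 - q)
  else 1 / q.

(** The cubic on [0, 1] with the values [q^2], 1 and the slopes [- q / q1], [1 / q] that the limit
    has at 0 and 1; already the first approximation then glues in a C^1 way. *)
Definition base_coef (R : realType) (s : nat -> bool) : R * R * R * R :=
  let q := scaling R s in let q1 := scaling R (shift_seq s) in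
  (q ^+ 2, q ^+ 2 - q / q1 / 3, 1 - 1 / q / 3, 1).

Definition base (R : realType) (s : nat -> bool) (x : R) : R :=
  let: (b0, b1, b2, b3) := base_coef R s in bezier b0 b1 b2 b3 x.

Definition base' (R : realType) (s : nat -> bool) (x : R) : R :=
  let: (b0, b1, b2, b3) := base_coef R s in bezier' b0 b1 b2 b3 x.

(* The unimodal map attached to [s] is [1 - depth R s]. *)
Definition depth (R : realType) : (nat -> bool) -> R -> R :=
  selfsim (fun s => scaling R s ^+ 2) (@base R) (@outer R).

(** The multiplier is the one produced by differentiating [q^2 D (1 - x / q)], namely
    [q^2 (- 1 / q) = - q]. *)
Definition depth' (R : realType) : (nat -> bool) -> R -> R :=
  selfsim (fun s => - scaling R s) (@base' R) (@outer' R).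

Arguments outer : clear implicits.
Arguments outer' : clear implicits.
Arguments base : clear implicits.
Arguments base' : clear implicits.
Arguments depth : clear implicits.
Arguments depth' : clear implicits.

Lemma gap_width (R : realType) s : 1 / 4 <= 1 - scaling R s ^+ 2 - scaling R s <= 1.
Proof. by have := scaling_itv R s; nra. Qed.

(** Increasing control values make the filling strictly increasing, so the gap contains no further
    critical point. Three bits are involved, hence eight numerical cases. *)
Lemma outer_coef_lt (R : realType) s b0 b1 b2 b3 :
  outer_coef R s = (b0, b1, b2, b3) ->
  [/\ 0 < b0, b0 < b1, b1 < b2, b2 < b3 & b3 < 1].
Proof.
rewrite /outer_coef => -[<- <- <- <-]; rewrite /scaling; case: (s 0%N); case: (shift_seq s 0%N);
  case: (shift_seq (shift_seq s) 0%N); split; lra.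
Qed.

Lemma base_C1Lip (R : realType) s : C1Lip_on 96 0 1 (base R s) (base' R s).
Proof.
rewrite /base /base' /base_coef.
apply: (@C1Lip_on_le _ (6 * 1)); first by lra.
apply: C1Lip_on_bezier; rewrite ler_norml /scaling; 
  case: (s 0%N); case: (shift_seq s 0%N); lra.
Qed.

(** At [1 - q^2] itself the cubic branch is the one taken; its final value and slope are those of
    the line, which is the C^1 matching at the right end of the gap. *)
Lemma outer_line (R : realType) s (x : R) : 1 - scaling R s ^+ 2 <= x ->
  outer R s x = 1 - (1 - x) / scaling R s /\ outer' R s x = 1 / scaling R s.
Proof.
move=> px; rewrite /outer /outer' /outer_coef /bezier /bezier'.
have q0 := scaling_neq0 R s; have := gap_width R s.
set q := scaling R s in q0 px *; set w := 1 - q ^+ 2 - q => w0.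
have w1 : w != 0 by rewrite lt0r_neq0 //; lra.
have [xp|//] := leP x (1 - q ^+ 2).
have -> : x = 1 - q ^+ 2 by apply/eqP; rewrite eq_le px xp.
have -> : (1 - q ^+ 2 - q) / w = 1 by rewrite divff.
by split; rewrite subrr; field; rewrite ?w1 ?q0 ?scaling_neq0.
Qed.

(** These are [q^2] times the value [q1^2], and [- q] times the slope [- q1 / q2], that the next
    level has at 0: the C^1 matching at the left end of the gap. *)
Lemma outer_scaling (R : realType) s :
  let q := scaling R s in let q1 := scaling R (shift_seq s) in
  let q2 := scaling R (shift_seq (shift_seq s)) in
  outer R s q = q ^+ 2 * q1 ^+ 2 /\ outer' R s q = q * q1 / q2.
Proof.
rewrite /outer /outer' /outer_coef /bezier /bezier' /=.
have q2 := scaling_neq0 R (shift_seq (shift_seq s)); have := gap_width R s.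
have q0 := scaling_neq0 R s; have q1 := scaling_neq0 R (shift_seq s).
set q := scaling R s in q0 *; set w := 1 - q ^+ 2 - q => w0.
have w1 : w != 0 by rewrite lt0r_neq0 //; lra.
have -> : q <= 1 - q ^+ 2 by rewrite /w in w0; lra.
by rewrite subrr mul0r subr0; split; field; rewrite ?w1 ?q0 ?scaling_neq0.
Qed.

Lemma outer_C1Lip (R : realType) s :
  C1Lip_on 96 (scaling R s) 1 (outer R s) (outer' R s).
Proof.
have gw := gap_width R s; have q2 : 0 <= scaling R s ^+ 2 by exact: sqr_ge0.
apply: (@C1Lip_on_glue _ _ _ (1 - scaling R s ^+ 2)); [lra|lra| |].
  pose w := 1 - scaling R s ^+ 2 - scaling R s.
  have w0 : 0 < w by rewrite /w; lra.
  pose b0 := (outer_coef R s).1.1.1; pose b1 := (outer_coef R s).1.1.2.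
  pose b2 := (outer_coef R s).1.2; pose b3 := (outer_coef R s).2.
  apply: (@C1Lip_on_ext _ _ _ _ _ _
    (fun x => 1 * bezier b0 b1 b2 b3 (- scaling R s / w + 1 / w * x))
    (fun x => 1 * (1 / w) * bezier' b0 b1 b2 b3 (- scaling R s / w + 1 / w * x))).
  - move=> x /andP[_ xp]; rewrite /outer /outer_coef xp mul1r.
    by congr (bezier _ _ _ _ _); rewrite /w; field; rewrite lt0r_neq0.
  - move=> x /andP[_ xp]; rewrite /outer' /outer_coef xp !mul1r mulrC.
    by congr (_ * bezier' _ _ _ _ _); rewrite /w; field; rewrite lt0r_neq0.
  (* The constant is [96 = 6 * 4^2]: second differences are at most 1 and the gap has width at least
     1/4. *)
  apply: (@C1Lip_on_le _ (`|1| * (1 / w) ^+ 2 * (6 * 1))).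
    have iw0 : 0 < 1 / w by rewrite divr_gt0.
    have : 1 / w <= 4 by rewrite ler_pdivrMr //; rewrite /w; lra.
    by rewrite normr1; nra.
  apply: (@C1Lip_on_affine _ _ 0 1).
    apply: C1Lip_on_bezier; rewrite ler_norml /b0 /b1 /b2 /b3 /outer_coef /= /scaling;
    case: (s 0%N); case: (shift_seq s 0%N);
    case: (shift_seq (shift_seq s) 0%N); lra.
  move=> x /andP[qx xp]; have -> : - scaling R s / w + 1 / w * x = (x - scaling R s) / w.
    by field; rewrite lt0r_neq0.
  rewrite ler_pdivrMr // mul1r lerB // andbT.
  by apply: divr_ge0; [rewrite subr_ge0|exact: ltW].
apply: (@C1Lip_on_ext _ _ _ _ _ _ (fun x => (1 - 1 / scaling R s) + 1 / scaling R s * x)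
    (fun=> 1 / scaling R s)).
- move=> x /andP[px _]; rewrite (outer_line px).1; field; exact: scaling_neq0.
- by move=> x /andP[px _]; rewrite (outer_line px).2.
by apply: (@C1Lip_on_le _ 0) => //; exact: C1Lip_on_line.
Qed.

Lemma C1Lip_on_bound (R : realType) (L u v : R) (F d : R -> R) (x : R) :
  C1Lip_on L u v F d -> 0 <= L -> u <= x <= v -> `|d x| <= `|d u| + L * (v - u).
Proof.
move=> FL L0 Ix; have uv : u <= v by lra.
have Iu : u <= u <= v by rewrite lexx.
have [h _] := FL u x Iu Ix.
have -> : d x = d u + (d x - d u) by ring.
rewrite (le_trans (ler_normD _ _)) // lerD2l (le_trans h) //.
by rewrite ler_wpM2l // ler_norml; lra.
Qed.

Lemma outer_itv (R : realType) s (x : R) : scaling R s <= x -> x <= 1 ->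
  0 <= outer R s x <= 1.
Proof.
move=> qx x1; have [xp|xp] := leP x (1 - scaling R s ^+ 2); last first.
  rewrite (outer_line (ltW xp)).1; have q0 := scaling_gt0 R s.
  have : (1 - x) / scaling R s <= scaling R s.
    by rewrite ler_pdivrMr // -expr2; lra.
  have : 0 <= (1 - x) / scaling R s by rewrite divr_ge0 ?subr_ge0 // ltW.
  by have := scaling_itv R s; lra.
have gw := gap_width R s; rewrite /outer.
case E : (outer_coef R s) => [[[b0 b1] b2] b3]; have [? ? ? ? ?] := outer_coef_lt E.
rewrite xp.
apply: bezier_itv; try lra; apply/andP; split.
  by rewrite divr_ge0 ?subr_ge0 // (le_trans qx).
by rewrite ler_pdivrMr ?mul1r ?lerB //; lra.
Qed.

Lemma outer'_gt0 (R : realType) s (x : R) : scaling R s <= x -> 0 < outer' R s x.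
Proof.
move=> qx; have [xp|xp] := leP x (1 - scaling R s ^+ 2); last first.
  by rewrite (outer_line (ltW xp)).2 divr_gt0 // scaling_gt0.
have gw := gap_width R s; rewrite /outer'.
case E : (outer_coef R s) => [[[b0 b1] b2] b3]; have [? ? ? ? ?] := outer_coef_lt E.
rewrite xp.
have w0 : 0 < 1 - scaling R s ^+ 2 - scaling R s by lra.
apply: divr_gt0 => //; apply: bezier'_gt0 => //; apply/andP; split.
  by rewrite divr_ge0 ?subr_ge0 // (le_trans qx).
by rewrite ler_pdivrMr ?mul1r ?lerB.
Qed.

(** * The limit function [depth] and its derivative *)

Lemma depth_mult_half (R : realType) s : `|scaling R s ^+ 2| <= 1 / 2.
Proof. by rewrite ger0_norm ?sqr_ge0 //; have := scaling_itv R s; nra. Qed.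

Lemma depth'_mult_half (R : realType) s : `|- scaling R s| <= 1 / 2.
Proof. by rewrite normrN gtr0_norm ?scaling_gt0 // scaling_le_half. Qed.

Lemma base_bound (R : realType) s (x : R) : 0 <= x <= 1 -> `|base R s x| <= 1.
Proof.
move=> Ix; rewrite ler_norml /base /base_coef /scaling.
by case: (s 0%N); case: (shift_seq s 0%N); apply: bezier_itv => //; lra.
Qed.

Lemma outer_bound (R : realType) s (x : R) :
  scaling R s < x -> x <= 1 -> `|outer R s x| <= 1.
Proof.
move=> /ltW qx x1; have := outer_itv qx x1; rewrite ler_norml; lra.
Qed.

Lemma base_ends (R : realType) s :
  [/\ base R s 0 = scaling R s ^+ 2, base R s 1 = 1,
      base' R s 0 = - (scaling R s / scaling R (shift_seq s)) &
      base' R s 1 = 1 / scaling R s].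
Proof.
have q0 := scaling_neq0 R s; have q1 := scaling_neq0 R (shift_seq s).
rewrite /base /base' /base_coef /bezier /bezier'.
by split; field; rewrite ?q0 ?q1.
Qed.

(** The bound is [98 = 2 + 96]: the slope at 0 is at most 2 in absolute value, and it varies by at
    most 96 over an interval of length 1. *)
Lemma base'_bound (R : realType) s (x : R) : 0 <= x <= 1 -> `|base' R s x| <= 98.
Proof.
move=> /(C1Lip_on_bound (@base_C1Lip R s)) h; apply: le_trans (h _) _ => //.
have [_ _ -> _] := base_ends R s.
have : `|- (scaling R s / scaling R (shift_seq s))| <= 2.
  rewrite normrN ger0_norm ?divr_ge0 ?(ltW (scaling_gt0 _ _)) //.
  rewrite ler_pdivrMr ?scaling_gt0 //.
  by have := scaling_itv R s; have := scaling_itv R (shift_seq s); lra.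
lra.
Qed.

Lemma outer'_bound (R : realType) s (x : R) :
  scaling R s < x -> x <= 1 -> `|outer' R s x| <= 98.
Proof.
move=> qx x1; apply: le_trans (C1Lip_on_bound (@outer_C1Lip R s) _ _) _ => //.
  by rewrite (ltW qx).
rewrite (outer_scaling R s).2.
have : `|scaling R s * scaling R (shift_seq s) / scaling R (shift_seq (shift_seq s))| <= 2.
  rewrite ger0_norm ?divr_ge0 ?mulr_ge0 ?(ltW (scaling_gt0 _ _)) //.
  rewrite ler_pdivrMr ?scaling_gt0 //.
  have := scaling_itv R s; have := scaling_itv R (shift_seq s).
  have := scaling_itv R (shift_seq (shift_seq s)); nra.
have := scaling_itv R s; lra.
Qed.

Lemma depth_cvg (R : realType) s (x : R) : 0 <= x <= 1 ->
  selfsim_approx (fun s => scaling R s ^+ 2) (base R) (outer R) k s x @[k --> \oo]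
  --> depth R s x.
Proof.
exact: selfsim_cvg (@depth_mult_half R) (@base_bound R) (@outer_bound R) s x.
Qed.

Lemma depth'_cvg (R : realType) s (x : R) : 0 <= x <= 1 ->
  selfsim_approx (fun s => - scaling R s) (base' R) (outer' R) k s x @[k --> \oo]
  --> depth' R s x.
Proof.
exact: selfsim_cvg (@depth'_mult_half R) (@base'_bound R) (@outer'_bound R) s x.
Qed.

Lemma depth_in (R : realType) s (x : R) : 0 <= x <= scaling R s ->
  depth R s x = scaling R s ^+ 2 * depth R (shift_seq s) (1 - x / scaling R s).
Proof.
exact: selfsim_in (@depth_mult_half R) (@base_bound R) (@outer_bound R) s x.
Qed.

Lemma depth'_in (R : realType) s (x : R) : 0 <= x <= scaling R s ->
  depth' R s x = - scaling R s * depth' R (shift_seq s) (1 - x / scaling R s).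
Proof.
exact: selfsim_in (@depth'_mult_half R) (@base'_bound R) (@outer'_bound R) s x.
Qed.

Lemma depth_out (R : realType) s (x : R) : scaling R s < x ->
  depth R s x = outer R s x.
Proof. exact: selfsim_out. Qed.

Lemma depth'_out (R : realType) s (x : R) : scaling R s < x ->
  depth' R s x = outer' R s x.
Proof. exact: selfsim_out. Qed.

Lemma depth_tip (R : realType) s : depth R s (tip R s) = 0.
Proof.
exact: selfsim_tip (@depth_mult_half R) (@base_bound R) (@outer_bound R) s.
Qed.

Lemma depth'_tip (R : realType) s : depth' R s (tip R s) = 0.
Proof.
exact: selfsim_tip (@depth'_mult_half R) (@base'_bound R) (@outer'_bound R) s.
Qed.

Lemma depth_line (R : realType) s (x : R) : 1 - scaling R s ^+ 2 <= x ->
  depth R s x = 1 - (1 - x) / scaling R s.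
Proof.
move=> px; rewrite depth_out; first by rewrite (outer_line px).1.
by have := gap_width R s; lra.
Qed.

Lemma depth_1 (R : realType) s : depth R s 1 = 1.
Proof.
rewrite depth_line ?subrr ?mul0r ?subr0 //.
by rewrite lerBlDr lerDl sqr_ge0.
Qed.

Lemma depth_0 (R : realType) s : depth R s 0 = scaling R s ^+ 2.
Proof.
by rewrite depth_in ?lexx ?(ltW (scaling_gt0 _ _)) // mul0r subr0 depth_1 mulr1.
Qed.

Lemma depth_itv (R : realType) s (x : R) : 0 <= x <= 1 -> 0 <= depth R s x <= 1.
Proof.
move: s x; apply: tip_exit_ind.
- by move=> s; rewrite depth_tip lexx ler01.
- by move=> s x qx x1; rewrite depth_out // outer_itv // ltW.
- move=> s x Ix IH; rewrite depth_in //; have := scaling_itv R s; nra.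
Qed.

(** Off the tip, finitely many rescalings lead to the outer part, where the derivative is positive,
    and the multipliers [- q] never vanish. *)
Lemma depth'_eq0 (R : realType) s (x : R) : 0 <= x <= 1 -> depth' R s x = 0 ->
  x = tip R s.
Proof.
move: s x; apply: tip_exit_ind => //.
- by move=> s x qx _ /eqP; rewrite depth'_out // gt_eqF // outer'_gt0 // ltW.
- move=> s x Ix IH /eqP; rewrite depth'_in // mulf_eq0 oppr_eq0.
  rewrite (negbTE (scaling_neq0 R s)) /= => /eqP /IH; rewrite (tipE R s) => <-.
  by field; exact: scaling_neq0.
Qed.

(** The end data belong to the induction because gluing at [q] compares [outer] with the next level
    at 0, while the value and slope at 0 come from the next level at 1. The constant 96 is uniform
    in [k] since [q^2 (1 / q)^2 = 1]. *)
Lemma selfsim_approx_C1Lip (R : realType) k s :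
  let F := selfsim_approx (fun s => scaling R s ^+ 2) (base R) (outer R) k s in
  let d := selfsim_approx (fun s => - scaling R s) (base' R) (outer' R) k s in
  C1Lip_on 96 0 1 F d /\
  [/\ F 0 = scaling R s ^+ 2, F 1 = 1,
      d 0 = - (scaling R s / scaling R (shift_seq s)) & d 1 = 1 / scaling R s].
Proof.
elim: k s => [|k IH] s /=; first by split; [exact: base_C1Lip|exact: base_ends].
have q0 := scaling_gt0 R s; have nq0 := scaling_neq0 R s.
have q12 := scaling_le_half R s; have [eE dE] := outer_scaling R s.
have [FL [F0 F1 d0 d1]] := IH (shift_seq s).
have h1 : (1 <= scaling R s) = false by apply/negbTE; rewrite -ltNge; lra.
have p1 : 1 - scaling R s ^+ 2 <= 1 by rewrite lerBlDr lerDl sqr_ge0.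
rewrite (ltW q0) h1 mul0r subr0 F1 d1 (outer_line p1).1 (outer_line p1).2.
rewrite subrr mul0r subr0 mulr1 mulNr mul1r; split=> //.
apply: (@C1Lip_on_glue _ _ _ (scaling R s)); [exact: ltW|lra| |]; last first.
  apply: C1Lip_on_ext (@outer_C1Lip R s) => x /andP[qx x1].
    case: leP => xq //; have -> : x = scaling R s by apply/eqP; rewrite eq_le xq qx.
    by rewrite divff // subrr F0 eE.
  case: leP => xq //; have -> : x = scaling R s by apply/eqP; rewrite eq_le xq qx.
  by rewrite divff // subrr d0 dE; field; rewrite !scaling_neq0.
have := @C1Lip_on_affine _ _ 0 1 0 (scaling R s) (scaling R s ^+ 2) 1
  (- (1 / scaling R s)) _ _ FL.
have -> : `|scaling R s ^+ 2| * (- (1 / scaling R s)) ^+ 2 * 96 = 96.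
  by rewrite ger0_norm ?sqr_ge0 //; field.
move=> H; apply: C1Lip_on_ext (H _) => x Ix.
- have -> : x <= scaling R s by case/andP: Ix.
  by congr (_ * selfsim_approx _ _ _ _ _ _); field.
- have -> : x <= scaling R s by case/andP: Ix.
  have -> : 1 + - (1 / scaling R s) * x = 1 - x / scaling R s by field.
  by field.
- have -> : 1 + - (1 / scaling R s) * x = 1 - x / scaling R s by field.
  exact: rescale_itv.
Qed.

Lemma depth_C1Lip (R : realType) s : C1Lip_on 96 0 1 (depth R s) (depth' R s).
Proof.
apply: C1Lip_on_lim; [exact: depth_cvg|exact: depth'_cvg|].
by move=> k; case: (selfsim_approx_C1Lip R k s).
Qed.

Lemma depth_surj (R : realType) s (y : R) : 0 <= y <= 1 ->
  exists2 x, 0 <= x <= 1 & depth R s x = y.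
Proof.
move=> /andP[y0 y1]; have It := tip_itv R s; have t1 : tip R s <= 1 by lra.
have cont : {within `[tip R s, 1], continuous (depth R s)}.
  apply: (@C1Lip_on_continuous _ 96 _ _ _ (depth' R s)) => a b Ia Ib.
  by apply: (@depth_C1Lip R s); lra.
have [|x] := IVT t1 cont (v := y).
  by rewrite depth_tip depth_1 min_l // max_r // y0.
by rewrite in_itv /= => Ix <-; exists x => //; lra.
Qed.

(* 12/5 lies between the values of [depth / (x - tip) ^ 2] at the two ends of
   the affine piece, whatever [s] is; pulling back keeps this quotient. *)
Lemma depth_parabola (R : realType) k s : exists x : R,
  [/\ 0 <= x <= 1, x != tip R s, `|x - tip R s| <= 1 / 2 ^+ k &
      depth R s x = 12 / 5 * (x - tip R s) ^+ 2].
Proof.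
elim: k s => [|k IH] s.
  have tE := tipE R s; have It := tip_itv R (shift_seq s); have It' := tip_itv R s.
  have Iq := scaling_itv R s; have gw := gap_width R s.
  set c := tip R s in tE It' *; set q := scaling R s in tE Iq gw *.
  (* [h] is [depth] minus the parabola on the affine piece; it is nonnegative at [1 - q^2] and
     nonpositive at 1, hence vanishes in between. *)
  pose h (t : R) := 1 - (1 - t) / q - 12 / 5 * ((t - c) * (t - c)).
  have cont : {within `[1 - q ^+ 2, 1], continuous h}.
    apply: continuous_subspaceT => t; apply: cvgB; first apply: cvgB.
    - exact: cvg_cst.
    - by apply: cvgMl; apply: cvgB; [exact: cvg_cst|exact: cvg_id].
    - by apply: cvgMr; apply: cvgM; (apply: cvgB; [exact: cvg_id|exact: cvg_cst]).
  have p1 : 1 - q ^+ 2 <= 1 by rewrite lerBlDr lerDl sqr_ge0.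
  have h1 : h 1 <= 0 by rewrite /h subrr mul0r subr0; nra.
  have hp : 0 <= h (1 - q ^+ 2).
    rewrite /h (_ : (1 - (1 - q ^+ 2)) / q = q); last by field; exact: scaling_neq0.
    move: tE; rewrite /q /scaling; case: (s 0%N) => tE; nra.
  have [|t] := IVT p1 cont (v := 0).
    by rewrite min_r ?max_l ?h1 ?hp // (le_trans h1).
  rewrite in_itv /= => /andP[pt t1] ht; exists t; split.
  - by apply/andP; split => //; lra.
  - by rewrite gt_eqF //; lra.
  - by rewrite expr0 ler_norml; lra.
  - by rewrite depth_line //; move: ht; rewrite /h -/q expr2; lra.
have [x [Ix xt xk dx]] := IH (shift_seq s).
have q0 := scaling_gt0 R s; have nq0 := scaling_neq0 R s.
exists (scaling R s * (1 - x)).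
have Iqx : 0 <= scaling R s * (1 - x) <= scaling R s.
  by apply/andP; split; [apply: mulr_ge0; lra|rewrite ger_pMr //; lra].
have e : scaling R s * (1 - x) - tip R s = - (scaling R s * (x - tip R (shift_seq s))).
  by rewrite (tipE R s); ring.
split.
- by have := scaling_le_half R s; lra.
- by rewrite -subr_eq0 e oppr_eq0 mulf_neq0 // subr_eq0.
- by rewrite e normrN normrM (gtr0_norm q0) half_scaling_bound.
- rewrite depth_in // (_ : 1 - _ = x); last by field.
  by rewrite dx e; ring.
Qed.

(** * The unimodal map and its renormalization *)

Section Unimodal.
Context (R : realType) (s : nat -> bool) (g : R -> R).
(** Agreement with [1 - depth] is assumed on [0, 1] alone, so that the section applies to the
    iterated renormalizations, which are identified only there. *)
Context (gE : forall x, 0 <= x <= 1 -> g x = 1 - depth R s x).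

Let c := tip R s.
Let q := scaling R s.

Let c_itv : 0 < c < 1.
Proof. by have := tip_itv R s; rewrite /c; lra. Qed.

Let g_tip : g c = 1.
Proof. by rewrite gE ?depth_tip ?subr0 //; have := c_itv; lra. Qed.

Let g_1 : g 1 = 0.
Proof. by rewrite gE ?depth_1 ?subrr // ler01 lexx. Qed.

Let g_0 : g 0 = 1 - q ^+ 2.
Proof. by rewrite gE ?depth_0 // ler01 lexx. Qed.

Let q2_itv : 0 <= 1 - q ^+ 2 <= 1.
Proof. by have := scaling_gt0 R s; have := gap_width R s; rewrite -/q; nra. Qed.

Let g_line x : 1 - q ^+ 2 <= x -> x <= 1 -> g x = (1 - x) / q.
Proof.
move=> px x1; rewrite gE; last by have := q2_itv; lra.
by rewrite depth_line // opprB addrC subrK.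
Qed.

Let g_p : g (1 - q ^+ 2) = q.
Proof.
have /andP[_ p1] := q2_itv; rewrite g_line //.
by rewrite /q; field; exact: scaling_neq0.
Qed.

Lemma C1Lip_on_unimodal : C1Lip_on 96 0 1 g (fun x => - depth' R s x).
Proof.
apply: (@C1Lip_on_ext _ _ _ _ _ _ (fun x => 1 - depth R s x)) => // x y Ix Iy.
have [h1 h2] := @depth_C1Lip R s x y Ix Iy.
split; first by rewrite -opprD normrN.
by rewrite -normrN; move: h2; congr (`|_| <= _); ring.
Qed.

Lemma critical_point_unique : unique (critical_point g) c.
Proof.
have Hd x : 0 <= x <= 1 -> deriv01 g x = - depth' R s x.
  by move=> /unit_intervalE Ix; exact: (C1Lip_on_deriv01 C1Lip_on_unimodal Ix).2.
split; first by split=> //; rewrite Hd ?depth'_tip ?oppr0 //; have := c_itv; lra.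
move=> x [Ix]; have {}Ix : 0 <= x <= 1 by lra.
by rewrite Hd // => /eqP; rewrite oppr_eq0 => /eqP /(depth'_eq0 Ix) ->.
Qed.

Lemma crit_tip : crit g = c.
Proof.
have [h1 h2] := critical_point_unique.
by apply: get_unique => // y /h2.
Qed.

Lemma unimodal_map : unimodal g.
Proof.
split=> //.
- move=> _ [x /unit_intervalE Ix <-]; apply/unit_intervalE; rewrite gE //.
  by have := depth_itv s Ix; lra.
- by case: (C1Lip_on_C1Lip_01 C1Lip_on_unimodal).
- by exists c; split=> //; exact: critical_point_unique.
Qed.

Lemma quadratic_tip_map : quadratic_tip g (crit g).
Proof.
rewrite crit_tip; have [x Hx] := choice (fun k => depth_parabola R k s).
exists x, (12 / 5); split.
- by lra.
- by move=> n; have [Ix xt _ _] := Hx n; split=> //; exact/unit_intervalE.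
- apply/cvgrPdist_le => e e0; have [k hk] := half_pow_lt 1 e0.
  exists k => // n /= kn; have [_ _ xn _] := Hx n; rewrite distrC.
  apply: le_trans xn (le_trans _ (ltW (le_lt_trans (ler_norm _) hk))).
  by rewrite ler_pM2l // lef_pV2 ?posrE ?exprn_gt0 // ler_weXn2l // ler1n.
(* Along the points of [depth_parabola] the quotient is constant, equal to [- 12/5]. *)
- have -> : (fun n => (g (x n) - g c) / (x n - c) ^+ 2) = (fun=> - (12 / 5)).
    apply/funext => n; have [Ix xt _ dx] := Hx n.
    rewrite gE // g_tip dx -/c; field.
    by rewrite subr_eq0.
  exact: cvg_cst.
Qed.

(** The critical orbit runs through [c], 1, 0, [1 - q^2], [q], so [I01] is [0, q] and [I11] is
    [1 - q^2, 1]. *)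
Let iters : [/\ iter 2 g (crit g) = 0, iter 3 g (crit g) = 1 - q ^+ 2 &
                iter 4 g (crit g) = q].
Proof. by rewrite /= crit_tip g_tip g_1 g_0 g_p. Qed.

Lemma renormalizable_map : renormalizable g.
Proof.
have q0 : 0 < q by exact: scaling_gt0.
have gw : 1 / 4 <= 1 - q ^+ 2 - q <= 1 := gap_width R s.
have [i2 i3 i4] := iters.
rewrite /renormalizable /I01 /I11 i2 i3 i4; split.
- by split; [exact: unimodal_map|exact: quadratic_tip_map].
- by rewrite crit_tip /= in_itv; exact: tip_le_scaling.
- rewrite crit_tip g_tip; apply/seteqP; split.
    move=> _ [x + <-]; rewrite /= !in_itv /= => Ix.
    rewrite gE; last by have := scaling_le_half R s; rewrite -/q; lra.
    rewrite depth_in // -/q.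
    by have := depth_itv (shift_seq s) (rescale_itv Ix); rewrite -/q; nra.
  move=> y; rewrite /= in_itv /= => /andP[py y1].
  (* On [0, q] the equation [g z = y] becomes, after rescaling, that the next level takes the value
     [(1 - y) / q^2]. *)
  have [|x Ix dx] := @depth_surj R (shift_seq s) ((1 - y) / q ^+ 2).
    rewrite divr_ge0 ?subr_ge0 ?sqr_ge0 // ler_pdivrMr ?exprn_gt0 // mul1r; lra.
  have Iqx : 0 <= q * (1 - x) <= q.
    by apply/andP; split; [apply: mulr_ge0; lra|rewrite ger_pMr //; lra].
  exists (q * (1 - x)); first by rewrite /= in_itv.
  rewrite gE; last by have := scaling_le_half R s; rewrite -/q; lra.
  rewrite depth_in // -/q (_ : 1 - q * (1 - x) / q = x); last by field; exact: lt0r_neq0.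
  by rewrite dx; field; exact: lt0r_neq0.
- rewrite crit_tip g_tip -subset0 => x []; rewrite /= !in_itv /=; lra.
Qed.

(** Write [D] for the next level. The rescaling sends [x] to [q (1 - x)], which [g] maps to
    [1 - q^2 D x]; there [g] is affine of slope [- 1 / q] and gives [q D x], which the inverse
    rescaling sends to [1 - D x]. *)
Lemma renormalization_map x : 0 <= x <= 1 ->
  renormalization g x = 1 - depth R (shift_seq s) x.
Proof.
have q0 : 0 < q by exact: scaling_gt0.
have nq0 : q != 0 by exact: lt0r_neq0.
move=> Ix; have [i2 _ i4] := iters; rewrite /renormalization i2 i4.
have -> : line_path q 0 x = q * (1 - x) by rewrite /line_path; ring.
have Iqx : 0 <= q * (1 - x) <= q.
  by apply/andP; split; [apply: mulr_ge0; lra|rewrite ger_pMr //; lra].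
have -> : iter 2 g (q * (1 - x)) = q * depth R (shift_seq s) x.
  rewrite /= (gE (x := q * (1 - x))); last by have := scaling_le_half R s; rewrite -/q; lra.
  rewrite depth_in // -/q (_ : 1 - q * (1 - x) / q = x); last by field.
  have := depth_itv (shift_seq s) Ix => Id.
  rewrite g_line; [by field|nra|nra].
by rewrite /factor; field.
Qed.
End Unimodal.

(** * Iterated renormalization and density of the critical points *)

Lemma iter_renormalization_map (R : realType) s n (x : R) : 0 <= x <= 1 ->
  iter n (@renormalization R) (fun x => 1 - depth R s x) x =
  1 - depth R (iter n shift_seq s) x.
Proof.
elim: n x => [//|n IH] x Ix; rewrite !iterS.
exact: (@renormalization_map R (iter n shift_seq s)).
Qed.

Unset Implicit Arguments.

Theorem theorem1p8 (R : realType) :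
  exists f : R -> R,
    [/\ unimodal f, C1Lip_01 f, quadratic_tip f (crit f),
        infinitely_renormalizable f &
        let c (n : nat) : R := crit (iter n (@renormalization R) f) in
        exists K : set R,
          [/\ cantor_set K, range c `<=` K & K `<=` closure (range c)]].
Proof.
pose w := universal_seq; exists (fun x => 1 - depth R w x); split.
- exact: unimodal_map.
- exact: C1Lip_on_C1Lip_01 (@C1Lip_on_unimodal R w _ _).
- exact: quadratic_tip_map.
- by move=> n; apply: renormalizable_map => x; exact: iter_renormalization_map.
move=> c; have cE n : c n = tip R (iter n shift_seq w).
  by apply: crit_tip => x; exact: iter_renormalization_map.
exists (range (tip R)); split; first exact: range_tip_cantor.
  by move=> _ [n _ <-]; rewrite cE; exists (iter n shift_seq w).
move=> _ [s _ <-] U /nbhs_ballP[e /= e0 eU].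
(* The first [k] letters of [s] occur in [w] at some position [n], so the critical point of the
   [n]-th renormalization is within [1 / 2^k] of [tip R s]. *)
have [k hk] := half_pow_lt 1 e0; have [n hn] := universal_seqP s k.
exists (c n); split; first by exists n.
apply: eU; rewrite -ball_normE /= cE.
apply: le_lt_trans (le_lt_trans (ler_norm _) hk); apply: tip_dist => i ik.
by rewrite iter_shift_seq /w hn.
Qed.
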